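(* Let $n\geq 2$ be an integer. If $G$ is a locally $n$-indicable group, then each maximal $(n-1)$-generated subgroup of $G$ is left relatively convex in $G$. In particular, in a free group, each maximal cyclic subgroup is left relatively convex.
   Context: A group is $n$-indicable ($n$ a positive integer) if it can be generated by fewer than $n$ elements or it admits a surjective homomorphism onto $\mathbb{Z}^n$. A group $G$ is locally $n$-indicable if every finitely generated subgroup of $G$ is $n$-indicable. A maximal $(n-1)$-generated subgroup of $G$ is a subgroup that is maximal, with respect to inclusion, among the subgroups of $G$ that can be generated by $n-1$ elements; a maximal cyclic subgroup is one maximal, with respect to inclusion, among the cyclic subgroups. An order on a set is a transitive, trichotomous binary relation (a strict total order). A subgroup $H$ of a group $G$ is left relatively convex in $G$ if the left $G$-set $G/H$ of left cosets admits at least one $G$-invariant order. Free groups may have any rank. *)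

(* Defs.v *)
From HB Require Import structures.
From mathcomp Require Import all_boot all_algebra.
From mathcomp Require Import boolp classical_sets.

Set Implicit Arguments.
Unset Strict Implicit.
Unset Printing Implicit Defensive.

Local Open Scope classical_set_scope.
Local Open Scope group_scope.

(* Possibly infinite groups are [groupType]s, and subgroups are sets of
   elements closed under the group operations. A group G is identified with
   its subgroup [setT]. *)

Definition is_subgroup (G : groupType) (H : set G) : Prop :=
  group_closed [in H].

Definition generated (G : groupType) (A : set G) : set G :=
  smallest (@is_subgroup G) A.

(* The k generators need not be distinct. *)
Definition generated_by (G : groupType) (k : nat) (H : set G) : Prop :=
  exists s : k.-tuple G, H = generated [set` s].

Definition finitely_generated (G : groupType) (H : set G) : Prop :=
  exists k : nat, generated_by k H.

Definition cyclic (G : groupType) (H : set G) : Prop :=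
  exists x : G, H = generated [set x].

Definition maximal_subset (G : groupType) (P : set G -> Prop) (H : set G) :
    Prop :=
  P H /\ forall K : set G, P K -> H `<=` K -> K = H.

Definition maximal_generated_by (G : groupType) (k : nat) (H : set G) : Prop :=
  maximal_subset (@generated_by G k) H.

Definition maximal_cyclic (G : groupType) (H : set G) : Prop :=
  maximal_subset (@cyclic G) H.

(* Z^n is the additive group 'rV[int]_n. A homomorphism defined on the
   subgroup H is a function on G that is multiplicative on H; its values
   outside H are irrelevant. *)
Definition surjects_onto_Zn (G : groupType) (n : nat) (H : set G) : Prop :=
  exists f : G -> 'rV[int]_n,
    (forall x y : G, H x -> H y -> f (x * y) = (f x + f y)%R) /\
    [set f x | x in H] = setT.

(* Meant for a subgroup H, regarded as a group in its own right. *)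
Definition indicable (G : groupType) (n : nat) (H : set G) : Prop :=
  (exists2 k : nat, (k < n)%N & generated_by k H) \/ surjects_onto_Zn n H.

Definition locally_indicable (n : nat) (G : groupType) : Prop :=
  forall H : set G, finitely_generated H -> indicable n H.

Definition ltranslate (G : groupType) (g : G) (A : set G) : set G :=
  [set g * x | x in A].

Definition left_cosets (G : groupType) (H : set G) : set (set G) :=
  [set ltranslate g H | g in setT].

Definition trichotomous_on (T : Type) (X : set T) (lt : T -> T -> Prop) : Prop :=
  forall a b : T, X a -> X b ->
    [\/ [/\ lt a b, a <> b & ~ lt b a],
        [/\ ~ lt a b, a = b & ~ lt b a]
      | [/\ ~ lt a b, a <> b & lt b a]].

Definition transitive_on (T : Type) (X : set T) (lt : T -> T -> Prop) : Prop :=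
  forall a b c : T, X a -> X b -> X c -> lt a b -> lt b c -> lt a c.

Definition is_order_on (T : Type) (X : set T) (lt : T -> T -> Prop) : Prop :=
  transitive_on X lt /\ trichotomous_on X lt.

(* The left G-set G/H is [left_cosets H], on which g acts by [ltranslate g].
   Only the values of [lt] on left cosets matter. *)
Definition left_relatively_convex (G : groupType) (H : set G) : Prop :=
  is_subgroup H /\
  exists lt : set G -> set G -> Prop,
    is_order_on (left_cosets H) lt /\
    forall (g : G) (A B : set G), left_cosets H A -> left_cosets H B ->
      lt A B -> lt (ltranslate g A) (ltranslate g B).

(* Universal property of a free basis: every map from B to a group K extends
   uniquely to a homomorphism. The map is given as the restriction to B of a
   function on G. *)
Definition free_basis (G : groupType) (B : set G) : Prop :=
  forall (K : groupType) (f : G -> K),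
    exists phi : {multiplicative G -> K},
      (forall b : G, B b -> phi b = f b) /\
      forall psi : {multiplicative G -> K},
        (forall b : G, B b -> psi b = f b) -> psi =1 phi.

Definition free_group (G : groupType) : Prop :=
  exists B : set G, free_basis B.

(* Main.v *)
(* A subgroup H is left relatively convex as soon as, for every finite set X not
   contained in H, some homomorphism from a subgroup containing H and X to an
   ordered abelian group kills H but not X: by induction this orders finite
   pieces of the complement of H, and a limit along an ultrafilter orders the
   whole. If H is maximal (n-1)-generated, <H, X> maps onto Z^n by
   n-indicability, and n - 1 elements of Z^n lie in the kernel of a nonzero
   linear form.

   For free groups, local 2-indicability is obtained without the Nielsen-Schreier
   theorem: Magnus' unitriangular integer representations are jointly faithful,
   and in a group with this property every subgroup is cyclic or maps onto Z^2. *)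
From HB Require Import structures.
Require Import Defs.
From mathcomp Require Import all_boot all_order all_algebra.
From mathcomp Require Import boolp classical_sets filter.

Set Implicit Arguments.
Unset Strict Implicit.
Unset Printing Implicit Defensive.

Import Order.TTheory GRing.Theory Num.Theory.
Local Open Scope classical_set_scope.
Local Open Scope group_scope.

(** * Subgroups and generation *)

Section Subgroups.
Variables (G : groupType) (H : set G).

Lemma is_subgroupP :
  is_subgroup H <-> H 1 /\ forall x y, H x -> H y -> H (x / y).
Proof.
split=> [[H1 HF]|[H1 HF]].
  split; first by rewrite -in_setE.
  by move=> x y Hx Hy; rewrite -in_setE; apply: HF; rewrite in_setE.
split; first by rewrite in_setE.
by move=> x y; rewrite !in_setE; apply: HF.
Qed.

Hypothesis sgH : is_subgroup H.

Lemma subgroup1 : H 1.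
Proof. by have /is_subgroupP[] := sgH. Qed.

Lemma subgroupF x y : H x -> H y -> H (x / y).
Proof. by have /is_subgroupP[_] := sgH; apply. Qed.

Lemma subgroupV x : H x -> H x^-1.
Proof. by rewrite -[x^-1]mul1g; apply/subgroupF/subgroup1. Qed.

Lemma subgroupM x y : H x -> H y -> H (x * y).
Proof. by move=> Hx /subgroupV Hy; rewrite -[y]invgK; apply: subgroupF. Qed.

End Subgroups.

Lemma generated_subgroup (G : groupType) (A : set G) :
  is_subgroup (generated A).
Proof.
apply/is_subgroupP; split=> [K [sgK _]|x y Ax Ay K sK]; first exact: subgroup1.
by apply: subgroupF (Ax K sK) (Ay K sK); case: sK.
Qed.

Lemma sub_generated (G : groupType) (A : set G) : A `<=` generated A.
Proof. exact: sub_gen_smallest. Qed.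

Lemma generated_sub (G : groupType) (A H : set G) :
  is_subgroup H -> A `<=` H -> generated A `<=` H.
Proof. exact: smallest_sub. Qed.

(* When P and P^-1 cover the complement of H, such a P is the same thing as an
   invariant order on the left cosets of H. *)
Definition relative_cone (G : groupType) (H P : set G) : Prop :=
  [/\ forall x y, P x -> P y -> P (x * y),
      forall h x, H h -> P x -> P (h * x),
      forall h x, H h -> P x -> P (x * h)
    & forall x, P x -> ~ H x].

(** * Orders on left cosets from relative cones *)

Section RelativeConvexity.
Variables (G : groupType) (H : set G).
Hypothesis sgH : is_subgroup H.

Lemma left_cosetsP (A : set G) :
  left_cosets H A -> exists a, A = ltranslate a H.
Proof. by move=> [a _ <-]; exists a. Qed.

Lemma ltranslateM (a b : G) (A : set G) :
  ltranslate a (ltranslate b A) = ltranslate (a * b) A.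
Proof.
apply/seteqP; split=> [_ [_ [x Ax <-] <-]|_ [x Ax <-]].
  by exists x; rewrite ?mulgA.
by exists (b * x); [exists x | rewrite mulgA].
Qed.

Lemma eq_ltranslate a b :
  (ltranslate a H = ltranslate b H) = H (a^-1 * b).
Proof.
apply/propext; split=> [eab|Hab].
  have : ltranslate b H b by exists 1; rewrite ?mulg1//; apply: subgroup1.
  by rewrite -eab => -[h Hh <-]; rewrite mulKg.
apply/seteqP; split=> _ [h Hh <-].
  exists ((a^-1 * b)^-1 * h); last by rewrite invgM invgK !mulgA mulgV mul1g.
  by apply: subgroupM => //; apply: subgroupV.
exists (a^-1 * b * h); last by rewrite !mulgA mulgV mul1g.
exact: subgroupM.
Qed.

(** Setting [aH < bH] when [a^-1 * b] lies in [P] does not depend on representatives, because [P]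
    absorbs [H] on both sides. *)
Lemma relative_cone_convex (P : set G) :
  relative_cone H P -> (forall g, [\/ H g, P g | P g^-1]) ->
  left_relatively_convex H.
Proof.
move=> [PM HP PH PnH] tot; split=> //.
pose lt A B := exists a b, [/\ A = ltranslate a H, B = ltranslate b H
  & P (a^-1 * b)].
have ltE a b : lt (ltranslate a H) (ltranslate b H) = P (a^-1 * b).
  apply/propext; split=> [[c [d []]]|]; last by exists a, b.
  rewrite !eq_ltranslate => Hac Hbd Pcd.
  have -> : a^-1 * b = (a^-1 * c) * (c^-1 * d) * (b^-1 * d)^-1.
    by rewrite invgM invgK !mulgA !mulgK.
  by apply: PH; [apply: subgroupV | apply: HP].
have PN x : P x -> ~ P x^-1.
  move=> Px PVx; apply: (PnH 1) (subgroup1 sgH).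
  by rewrite -(mulgV x); apply: PM.
exists lt; split; [split|].
- move=> _ _ _ /left_cosetsP[a ->] /left_cosetsP[b ->] /left_cosetsP[c ->].
  rewrite !ltE => Pab Pbc; rewrite -[c](mulVKg b) mulgA; exact: PM.
- move=> _ _ /left_cosetsP[a ->] /left_cosetsP[b ->].
  have abV : b^-1 * a = (a^-1 * b)^-1 by rewrite invgM invgK.
  rewrite !ltE abV eq_ltranslate; case: (tot (a^-1 * b)) => [Hx|Px|PVx].
  + by apply: Or32; split=> // [/PnH//|/PnH]; apply; apply: subgroupV.
  + by apply: Or31; split=> //; [apply: PnH | apply: PN].
  + apply: Or33; split=> //; first by move/PN.
    by move=> Hx; apply: PnH PVx _; apply: subgroupV.
- move=> g _ _ /left_cosetsP[a ->] /left_cosetsP[b ->].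
  by rewrite !ltranslateM !ltE invgM -mulgA mulKg.
Qed.

(* Compactness: the condition on all of G reduces to finite sets, by taking a
   limit of the cones along an ultrafilter on the finite sets. *)
Lemma finite_cones_convex :
  (forall X : seq G, exists P, relative_cone H P /\
     forall x, x \in X -> [\/ H x, P x | P x^-1]) ->
  left_relatively_convex H.
Proof.
move=> /choice[P /all_and2[coneP totP]].
(* The sets [up X] form a base of a proper filter; along an ultrafilter refining it, whatever holds
   for all large enough lists holds almost everywhere. *)
pose up (X : seq G) := [set Y : seq G | {subset X <= Y}].
have pF : ProperFilter (filter_from setT up).
  apply: filter_from_proper => [|X _]; last by exists X => x.
  apply: filter_fromT_filter; first by exists [::].
  move=> X Y; exists (X ++ Y) => Z XYZ; split=> x xX; apply: XYZ.
    by rewrite mem_cat xX.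
  by rewrite mem_cat xX orbT.
have [U [ultraU upU]] := ultraFilterLemma pF.
have fU : Filter U := filter_filter.
apply: (@relative_cone_convex [set g | U [set X | P X g]]).
  split=> [x y Ux Uy|h x Hh|h x Hh|x Ux Hx].
  - apply: filterS (filterI Ux Uy) => X [Px Py].
    by have [+ _ _ _] := coneP X; apply.
  - by apply: filterS => X /= Px; have [_ + _ _] := coneP X; apply.
  - by apply: filterS => X /= Px; have [_ _ + _] := coneP X; apply.
  - apply: (filter_not_empty U); apply: filterS Ux => X Px.
    by have [_ _ _ /(_ x Px)] := coneP X.
move=> g; have [Hg|nHg] := pselect (H g); first by apply: Or31.
(* The ultrafilter decides [P X g]; if this fails almost everywhere, [P X g^-1] holds for almost all
   lists, since almost all contain [g]. *)
have [|UnP] := in_ultra_setVsetC [set X | P X g] ultraU; first by apply: Or32.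
apply: Or33 => /=; have Ug : U (up [:: g]) by apply: upU; exists [:: g].
apply: filterS (filterI Ug UnP) => X [/(_ g (mem_head _ _)) gX nPg].
by case: (totP X g gX).
Qed.

(* A homomorphism to an ordered group killing H decides the sign of the elements
   it does not kill; induction takes care of the remaining ones. *)
Lemma characters_convex (R : realDomainType) :
  (forall X : seq G, (exists2 x, x \in X & ~ H x) ->
     exists (K : set G) (f : G -> R),
       [/\ is_subgroup K, H `<=` K, [set` X] `<=` K,
           forall x y, K x -> K y -> f (x * y) = (f x + f y)%R
         & (forall h, H h -> f h = 0%R) /\
           exists2 x, x \in X & f x != 0%R]) ->
  left_relatively_convex H.
Proof.
move=> charH; apply: finite_cones_convex => X.
have [n] := ubnP (size X); elim: n => // n IHn in X *; rewrite ltnS => leXn.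
have [XH|] := pselect (forall x, x \in X -> H x).
  exists set0; split=> [|x /XH Hx]; last by apply: Or31.
  by split=> // x y [].
move=> /existsNP[x /not_implyP[xX nHx]].
have [K [f [sgK HK XK fM [fH [y yX fy]]]]] := charH X (ex_intro2 _ _ x xX nHx).
(* Strictly shorter than [X], since [f] does not kill [y]. *)
pose X' := [seq z <- X | f z == 0%R].
have [|P [[PM HP PH PnH] totP]] := IHn X'.
  apply: leq_trans leXn; rewrite size_filter.
  rewrite -(count_predC (fun z => f z == 0%R)).
  by rewrite -addn1 leq_add2l -has_count; apply/hasP; exists y.
(* Lexicographic positivity: first the sign of [f], then the inductive cone [P] on its kernel. *)
pose Q := [set g | K g /\ ((0 < f g)%R \/ f g = 0%R /\ P g)].
have f1 : f 1 = 0%R by apply: fH; apply: subgroup1.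
have fV z : K z -> f z^-1 = (- f z)%R.
  move=> Kz; apply/eqP; rewrite -addr_eq0 -fM ?mulVg ?f1//.
  exact: subgroupV.
exists Q; split.
  split=> [u v [Ku Qu] [Kv Qv]|h u Hh [Ku Qu]|h u Hh [Ku Qu]|u [Ku Qu] Hu].
  - split; first exact: subgroupM.
    rewrite fM//; case: Qu => [fu|[fu Pu]]; case: Qv => [fv|[fv Pv]].
    + by left; apply: addr_gt0.
    + by left; rewrite fv addr0.
    + by left; rewrite fu add0r.
    + by right; rewrite fu fv addr0; split=> //; apply: PM.
  - have Kh := HK h Hh; split; first exact: subgroupM.
    rewrite fM// (fH h)// add0r; case: Qu => [|[fu Pu]]; first by left.
    by right; split=> //; apply: HP.
  - have Kh := HK h Hh; split; first exact: subgroupM.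
    rewrite fM// (fH h)// addr0; case: Qu => [|[fu Pu]]; first by left.
    by right; split=> //; apply: PH.
  - case: Qu => [|[_ /PnH//]]; by rewrite fH// ltxx.
move=> z zX; have Kz := XK z zX.
case: (ltgtP (f z) 0%R) => fz.
- apply: Or33; split; first exact: subgroupV.
  by left; rewrite fV// oppr_gt0.
- by apply: Or32; split=> //; left.
- have zX' : z \in X' by rewrite mem_filter fz eqxx.
  case: (totP z zX') => [Hz|Pz|Pz]; [exact: Or31| |].
    by apply: Or32; split=> //; right.
  apply: Or33; split; first exact: subgroupV.
  by right; rewrite fV// fz oppr0.
Qed.

End RelativeConvexity.

(** * Maximal (n-1)-generated subgroups *)

(** Padding with copies of 1 makes exactly [k] generators the same as at most [k]. *)
Lemma generated_byP (G : groupType) (k : nat) (H : set G) :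
  generated_by k H <->
  exists2 s : seq G, (size s <= k)%N & H = generated [set` s].
Proof.
split=> [[s ->]|[s les ->]]; first by exists s; rewrite ?size_tuple.
have szs' : size (s ++ nseq (k - size s) 1) == k.
  by rewrite size_cat size_nseq subnKC.
exists (Tuple szs'); apply/seteqP; split.
  apply: generated_sub => [|x xs]; first exact: generated_subgroup.
  by apply: sub_generated; rewrite /= mem_cat xs.
apply: generated_sub => [|x /=]; first exact: generated_subgroup.
rewrite mem_cat => /orP[xs|/nseqP[-> _]]; first exact: sub_generated.
by apply: subgroup1; apply: generated_subgroup.
Qed.

Lemma underdetermined_solution (F : fieldType) (m n : nat) (M : 'M[F]_(n, m)) :
  (m < n)%N -> exists2 u : 'rV_n, u != 0%R & (u *m M = 0)%R.
Proof.
move=> ltmn; have /rowV0Pn[u /sub_kermxP uM u0] : (kermx M != 0)%R.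
  by rewrite kermx_eq0 /row_free ltn_eqF// (leq_ltn_trans (rank_leq_col M)).
by exists u.
Qed.

(** The images of [s] are fewer than [n] vectors of Q^n, so a nonzero linear form [u] vanishes on
    them; [chi] is [u] composed with the surjection. *)
Lemma Zn_character (G : groupType) (n : nat) (K : set G) (s : seq G) :
  surjects_onto_Zn n K -> (size s < n)%N ->
  exists chi : G -> rat,
    [/\ forall x y, K x -> K y -> chi (x * y) = (chi x + chi y)%R,
        forall x, x \in s -> chi x = 0%R
      & exists2 g, K g & chi g != 0%R].
Proof.
move=> [f [fM fsurj]] lts.
pose M : 'M[rat]_(n, size s) := (\matrix_(i, j) (f (nth 1%g s j) ord0 i)%:~R)%R.
have [u u0 uM] := underdetermined_solution M lts.
exists (fun g => \sum_i u ord0 i * (f g ord0 i)%:~R)%R; split.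
- move=> x y Kx Ky; rewrite fM// -big_split; apply: eq_bigr => i _ /=.
  by rewrite mxE rmorphD mulrDr.
- move=> x xs; have ltj : (index x s < size s)%N by rewrite index_mem.
  move/matrixP/(_ ord0 (Ordinal ltj)): uM; rewrite !mxE => uMj.
  rewrite -[RHS]uMj.
  by apply: eq_bigr => i _; rewrite !mxE nth_index.
- have [i ui] : exists i, u ord0 i != 0%R by apply/rV0Pn.
  have : setT (delta_mx ord0 i : 'rV[int]_n)%R by [].
  rewrite -fsurj => -[g Kg fg]; exists g => //.
  rewrite (bigD1 i)//= big1 ?addr0; first by rewrite fg mxE !eqxx mulr1.
  by move=> j ji; rewrite fg mxE (negbTE ji) andbF mulr0.
Qed.

Lemma maximal_generated_convex (G : groupType) (n : nat) (H : set G) :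
  (0 < n)%N -> locally_indicable n G -> maximal_generated_by n.-1 H ->
  left_relatively_convex H.
Proof.
move=> n0 indG [/generated_byP[s szs eH] maxH].
have sgH : is_subgroup H by rewrite eH; apply: generated_subgroup.
apply: (characters_convex sgH (R := rat)) => X [x xX nHx].
pose K := generated [set` s ++ X].
have sgK : is_subgroup K := generated_subgroup _.
have XK : [set` X] `<=` K.
  by move=> y yX; apply: sub_generated; rewrite /= mem_cat yX orbT.
have sK : [set` s] `<=` K.
  by move=> y ys; apply: sub_generated; rewrite /= mem_cat ys.
have HK : H `<=` K by rewrite eH; apply: generated_sub.
have /indG : finitely_generated K.
  by exists (size (s ++ X)); apply/generated_byP; exists (s ++ X).
case=> [[k ltk /generated_byP[t szt eK]]|KZ].
  (* Fewer than [n] generators means at most [n.-1], so maximality forces [K = H], although [X] is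
     not contained in [H]. *)
  suff eKH : K = H by case: nHx; rewrite -eKH; apply: XK.
  apply: maxH => //; apply/generated_byP; exists t => //.
  by rewrite (leq_trans szt)// -ltnS prednK.
have [|chi [chiM chis [g Kg chig]]] := Zn_character KZ (s := s).
  by rewrite -(prednK n0) ltnS.
(* The kernel of [chi] on [K] is a subgroup, so it is enough to kill generators. *)
have chi_gen (A : set G) : A `<=` K -> (forall y, A y -> chi y = 0%R) ->
    forall y, generated A y -> chi y = 0%R.
  move=> AK chiA.
  suff ker : generated A `<=` [set z | K z /\ chi z = 0%R] by move=> y /ker[].
  have chi1 : chi 1 = 0%R.
    have K1 := subgroup1 sgK; apply: (addrI (chi 1)).
    by rewrite -chiM// mulg1 addr0.
  apply: generated_sub; last by move=> z Az; split; [apply: AK|apply: chiA].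
  apply/is_subgroupP; split; first by split; [apply: (subgroup1 sgK)|].
  move=> a b [Ka a0] [Kb b0]; have KV := subgroupV sgK Kb.
  split; first exact: (subgroupF sgK).
  rewrite chiM// a0 add0r; apply: (addIr (chi b)).
  by rewrite -chiM// mulVg chi1 b0 addr0.
exists K, chi; split=> //; split=> [h|].
  by rewrite eH; apply: chi_gen.
(* If [chi] killed [X] as well as [s], it would vanish on all of [K], hence at [g]. *)
apply: contrapT => nX; case/eqP: chig.
apply: (chi_gen [set` s ++ X]) => // [y|y /=]; first exact: sub_generated.
rewrite mem_cat => /orP[/chis//|yX]; apply/eqP/negP => /negP y0.
by apply: nX; exists y.
Qed.

(** * Integer powers *)

Definition zexpg (G : groupType) (x : G) (m : int) : G :=
  match m with Posz n => x ^+ n | Negz n => x ^- n.+1 end.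

Section IntegerPowers.
Variables (G : groupType) (x : G).

Lemma zexpgS m : zexpg x (m + 1) = x * zexpg x m.
Proof.
case: m => [n|[|n]].
- by rewrite addrC -intS /= expgS.
- by rewrite NegzE addNr -[(- _)%R]NegzE /zexpg expg1 mulgV.
- rewrite NegzE; have -> : (- n.+2%:Z + 1 = - n.+1%:Z)%R.
    by rewrite [Posz n.+2]intS opprD addrAC addNr add0r.
  rewrite -[(- n.+1%:Z)%R]NegzE -[(- n.+2%:Z)%R]NegzE /zexpg.
  by rewrite [x ^+ n.+2]expgSr invgM mulVKg.
Qed.

Lemma zexpgB1 m : zexpg x (m - 1) = x^-1 * zexpg x m.
Proof. by rewrite -[m in RHS](subrK 1%R) zexpgS mulKg. Qed.

Lemma zexpgD m n : zexpg x (m + n) = zexpg x m * zexpg x n.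
Proof.
elim/int_rec: m => [|m IHm|m IHm]; first by rewrite add0r mul1g.
  rewrite intS addrC [(1 + _)%R]addrC addrA !zexpgS.
  by rewrite [(n + _)%R]addrC IHm mulgA.
by rewrite intS opprD [(-1 + _)%R]addrC addrAC !zexpgB1 IHm mulgA.
Qed.

Lemma zexpgN m : zexpg x (- m) = (zexpg x m)^-1.
Proof. by apply/esym/mulg1_eq; rewrite -zexpgD subrr. Qed.

Lemma subgroup_zexpg (H : set G) m : is_subgroup H -> H x -> H (zexpg x m).
Proof.
move=> sgH Hx; elim/int_rec: m => [|m IHm|m IHm].
- exact: subgroup1 sgH.
- by rewrite intS addrC zexpgS; apply: (subgroupM sgH).
- rewrite intS opprD addrC zexpgB1; apply: (subgroupM sgH) => //.
  exact: (subgroupV sgH).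
Qed.

End IntegerPowers.

(** * Integer-valued characters of a subgroup *)

Section CharactersOnSubgroups.
Variables (G : groupType) (K : set G).
Hypothesis sgK : is_subgroup K.

Definition character_on (f : G -> int) : Prop :=
  forall x y, K x -> K y -> f (x * y) = (f x + f y)%R.

Lemma character_on1 f : character_on f -> f 1 = 0%R.
Proof.
move=> fM; have K1 := subgroup1 sgK; apply: (addrI (f 1)).
by rewrite -fM// mulg1 addr0.
Qed.

Lemma character_onV f x : character_on f -> K x -> f x^-1 = (- f x)%R.
Proof.
move=> fM Kx; have KVx := subgroupV sgK Kx; apply: (addIr (f x)).
by rewrite -fM// mulVg addNr character_on1.
Qed.

Lemma character_on_zexpg f x m :
  character_on f -> K x -> f (zexpg x m) = (m * f x)%R.
Proof.
move=> fM Kx; have KVx := subgroupV sgK Kx.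
have Kz n : K (zexpg x n) by apply: subgroup_zexpg.
elim/int_rec: m => [|m IHm|m IHm]; first by rewrite mul0r character_on1.
  by rewrite intS addrC zexpgS fM// IHm mulrDl mul1r addrC.
rewrite intS opprD addrC zexpgB1 fM// character_onV// IHm.
by rewrite mulrDl mulN1r addrC.
Qed.

(** The image of [f] is a nonzero subgroup of Z; [c] is its least positive element, attained at [t],
    and [f'] is [f] divided by [c]. *)
Lemma character_on_generator f k : character_on f -> K k -> f k != 0%R ->
  exists (c : int) (f' : G -> int) (t : G),
    [/\ character_on f', K t, f' t = 1%R & forall x, K x -> f x = (c * f' x)%R].
Proof.
move=> fM Kk fk.
(* Shifted by one, so that the least [n] gives the least positive value [n.+1]. *)
pose P n := `[< exists2 t, K t & f t = Posz n.+1 >].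
have exP : exists n, P n.
  have KVk := subgroupV sgK Kk.
  case efk: (f k) fk => [[|n]|n] // _; exists n; apply/asboolP.
    by exists k.
  by exists k^-1; rewrite // character_onV// efk NegzE opprK.
case: (ex_minnP exP) => n /asboolP[t Kt ft] min_n.
have ft0 : f t != 0%R by rewrite ft.
have fdvd x : K x -> f x = (f t * (f x %/ f t)%Z)%R.
  move=> Kx; rewrite {1}(divz_eq (f x) (f t)) mulrC.
  have Kz := subgroup_zexpg (- (f x %/ f t)%Z)%R sgK Kt.
  (* [f y] is the remainder of [f x] modulo [f t]; a positive remainder would contradict
     minimality. *)
  pose y := x * zexpg t (- (f x %/ f t)%Z)%R.
  have Ky : K y by apply: (subgroupM sgK).
  have fy : f y = (f x %% f t)%Z.
    by rewrite fM// character_on_zexpg// /modz mulNr.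
  have := ltz_mod (f x) ft0; have := modz_ge0 (f x) ft0; rewrite -fy.
  case efy: (f y) => [[|r]|//] _; first by rewrite addr0.
  rewrite ft ger0_norm// ltz_nat ltnS => ltrn.
  suff /min_n : P r by rewrite leqNgt ltrn.
  by apply/asboolP; exists y.
exists (f t), (fun x => f x %/ f t)%Z, t; split=> //; last by rewrite divzz ft0.
move=> x y Kx Ky; apply: (mulfI ft0).
rewrite mulrDr -!fdvd ?fM//; exact: (subgroupM sgK).
Qed.

(** [t] and [s] go to the two basis vectors, so [t^a * s^b] goes to [(a, b)]. *)
Lemma characters_onto_Z2 (f g : G -> int) (t s : G) :
  character_on f -> character_on g -> K t -> K s ->
  f t = 1%R -> g t = 0%R -> f s = 0%R -> g s = 1%R ->
  surjects_onto_Zn 2 K.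
Proof.
move=> fM gM Kt Ks ft gt fs gs.
exists (fun x => \row_(i < 2) if i == ord0 then f x else g x)%R; split.
  by move=> x y Kx Ky; apply/rowP=> i; rewrite !mxE fM// gM//; case: ifP.
apply/seteqP; split=> // v _.
have Kzt := subgroup_zexpg (v ord0 ord0) sgK Kt.
have Kzs := subgroup_zexpg (v ord0 ord_max) sgK Ks.
exists (zexpg t (v ord0 ord0) * zexpg s (v ord0 ord_max)).
  exact: (subgroupM sgK).
apply/rowP=> i; rewrite !mxE fM// gM// !character_on_zexpg// ft gt fs gs.
rewrite !mulr0 !mulr1 addr0 add0r; case: i => [[|[]]] // lti.
  by congr (v _ _); apply: val_inj.
by congr (v _ _); apply: val_inj.
Qed.

End CharactersOnSubgroups.

(** * Subgroups of a group with a separating filtration *)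

Section CentralFiltration.
Variables (G : groupType) (L : Type) (deg : L -> nat) (lam : L -> G -> int).

(** The model is a group of unitriangular matrices, with [lam] the entries above the diagonal and
    [deg] their distance from it. *)
Definition filtration (j : nat) : set G :=
  [set g | forall l, (deg l < j)%N -> lam l g = 0%R].

Hypothesis lamMl : forall l g h,
  filtration (deg l) g -> lam l (g * h) = (lam l g + lam l h)%R.
Hypothesis lamMr : forall l g h,
  filtration (deg l) g -> lam l (h * g) = (lam l h + lam l g)%R.
Hypothesis faithful : forall g, (forall l, lam l g = 0%R) -> g = 1.

(* Let d be the degree at which the filtration first separates elements of K,
   say by a character phi of K, and let t generate K modulo ker phi. As lam is
   conjugation invariant to leading order, the leading terms on ker phi extend
   to characters of K killing t. Either one of them is nonzero and makes K map
   onto Z^2, or ker phi lies in every step of the filtration, so K is cyclic. *)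
Lemma filtered_cyclic_or_onto_Z2 (K : set G) :
  is_subgroup K -> cyclic K \/ surjects_onto_Zn 2 K.
Proof.
move=> sgK; have KM := subgroupM sgK; have KV := subgroupV sgK.
have [K1|/existsNP[k /not_implyP[Kk k1]]] := pselect (forall k, K k -> k = 1).
  left; exists 1; apply/seteqP; split=> [k /K1 ->|].
    by apply: sub_generated.
  by apply: generated_sub => // _ ->; apply: subgroup1.
pose P j := `[< exists l x, [/\ deg l = j, K x & lam l x != 0%R] >].
have exP : exists j, P j.
  have /existsNP[l /eqP lk] : ~ forall l, lam l k = 0%R by move/faithful.
  by exists (deg l); apply/asboolP; exists l, k.
case: (ex_minnP exP) => d /asboolP[l0 [x0 [dl0 Kx0 lx0]]] min_d.
have Kd x : K x -> filtration d x.
  move=> Kx l ltl; apply/eqP; apply: contraTT ltl => lx; rewrite -leqNgt.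
  by apply: min_d; apply/asboolP; exists l, x.
have phi0M : character_on K (lam l0).
  by move=> x y Kx Ky; apply: lamMl; rewrite dl0; apply: Kd.
have [c [phi [t [phiM Kt phit phi0E]]]] :=
  character_on_generator sgK phi0M Kx0 lx0.
(* The projection of [K] onto the kernel of [phi] along the powers of [t]. *)
pose r x := x * zexpg t (- phi x).
have Kz m : K (zexpg t m) by apply: subgroup_zexpg.
have Kr x : K x -> K (r x) by move=> Kx; apply: KM.
have phir x : K x -> phi (r x) = 0%R.
  by move=> Kx; rewrite phiM// (character_on_zexpg sgK)// phit mulr1 subrr.
have r_id x : phi x = 0%R -> r x = x.
  by rewrite /r => ->; rewrite oppr0 /= mulg1.
(* If the kernel lies in every step, faithfulness gives [r x = 1], so [x] is a power of [t]. *)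
have [kerF|] := pselect (forall j x, K x -> phi x = 0%R -> filtration j x).
  left; exists t; apply/seteqP; split=> [x Kx|]; last first.
    by apply: generated_sub => // _ ->.
  have rx1 : r x = 1.
    by apply: faithful => l; apply: (kerF (deg l).+1); [apply: Kr|apply: phir|].
  have -> : x = zexpg t (phi x).
    by apply: divg1_eq; rewrite -zexpgN.
  have sgT := generated_subgroup [set t].
  by apply: (subgroup_zexpg _ sgT); apply: sub_generated.
move=> /existsNP nker; right.
(* For the least step [j] not containing the kernel of [phi], a witness [l] has [deg l < j]; by
   minimality the whole kernel lies in step [deg l]. *)
pose Q j := `[< exists x, [/\ K x, phi x = 0%R & ~ filtration j x] >].
have exQ : exists j, Q j.
  have [j /existsNP[x /not_implyP[Kx /not_implyP[phix nfx]]]] := nker.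
  by exists j; apply/asboolP; exists x.
case: (ex_minnP exQ) => j /asboolP[u [Ku phiu nu]] min_j.
have [l /not_implyP[ltl /eqP lu]] :
    exists l, ~ ((deg l < j)%N -> lam l u = 0%R).
  exact/existsNP.
have kerF x : K x -> phi x = 0%R -> filtration (deg l) x.
  move=> Kx phix; apply: contrapT => nx.
  move: ltl; rewrite ltnNge => /negP; apply.
  by apply: min_j; apply/asboolP; exists x.
pose psi x := lam l (r x).
have psiM : character_on K psi.
  move=> x y Kx Ky; rewrite /psi.
  (* A conjugate of [r y] by a power of [t], chosen so that [r (x * y) = r x * w]. *)
  pose w := zexpg t (phi x) * r y * zexpg t (- phi x).
  have Kw : K w by apply/KM/Kz/KM/Kr.
  have phiw : phi w = 0%R.
    have Kry := Kr y Ky; have Kty := KM _ _ (Kz (phi x)) Kry.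
    rewrite /w phiM// [phi (_ * r y)]phiM// phir// !(character_on_zexpg sgK)//.
    by rewrite addr0 mulNr addrN.
  have -> : r (x * y) = r x * w.
    rewrite /w /r phiM// opprD [(- phi x - _)%R]addrC zexpgD !zexpgN.
    by rewrite !mulgA mulgVK.
  rewrite lamMl; last by apply: kerF; [apply: Kr|apply: phir].
  (* With [z] this power of [t], [w * z = z * r y]; expanding [lam l] on both sides and cancelling
     [lam l z] shows that [w] and [r y] have the same value. *)
  congr (_ + _)%R; apply: (addrI (lam l (zexpg t (phi x)))).
  rewrite -[RHS]lamMr; last by apply: kerF; [apply: Kr|apply: phir].
  rewrite addrC -lamMl; last exact: kerF.
  by rewrite /w zexpgN mulgVK.
have psiu : psi u != 0%R by rewrite /psi r_id.
have [e [chi [s [chiM Ks chis psiE]]]] :=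
  character_on_generator sgK psiM Ku psiu.
have e0 : e != 0%R by apply: contraNneq psiu => e0; rewrite psiE// e0 mul0r.
(* [r t = 1], so [psi] vanishes at [t]. *)
have chit : chi t = 0%R.
  apply: (mulfI e0); rewrite -psiE// mulr0 /psi /r phit /= mulgV.
  have K1 := subgroup1 sgK; have ker1 := kerF 1 K1 (character_on1 sgK phiM).
  by apply: (addrI (lam l 1)); rewrite -lamMl// mulg1 addr0.
(* Replacing [s] by [r s] makes [phi] vanish and keeps the value 1 of [chi], as [chi t = 0]. *)
apply: (characters_onto_Z2 sgK phiM chiM Kt (Kr _ Ks)) => //; first exact: phir.
by rewrite /r chiM// (character_on_zexpg sgK)// chit mulr0 addr0.
Qed.

End CentralFiltration.

(** * Unitriangular matrices *)

Definition unitriangular (R : nzRingType) (n : nat) (M : 'M[R]_n) : Prop :=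
  forall i j : 'I_n, (j <= i)%N -> M i j = (i == j)%:R%R.

Lemma unitriangular1 (R : nzRingType) (n : nat) :
  unitriangular (1%:M : 'M[R]_n)%R.
Proof. by move=> i j _; rewrite mxE. Qed.

Lemma unitriangularM (R : nzRingType) (n : nat) (M N : 'M[R]_n) :
  unitriangular M -> unitriangular N -> unitriangular (M *m N)%R.
Proof.
move=> uM uN i j leji; rewrite mxE (bigD1 i)//= uM// eqxx mul1r uN//.
rewrite big1 ?addr0// => k ki; case: (leqP k i) => [leki|ltik].
  by rewrite uM// eq_sym (negbTE ki) mul0r.
have ltjk := leq_ltn_trans leji ltik.
by rewrite uN ?(ltnW ltjk)// -val_eqE gtn_eqF// mulr0.
Qed.

(* The entries on the j-th superdiagonal are additive as soon as one of the two
   factors vanishes on the previous ones. *)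
Lemma unitriangular_mulmx_entry (R : nzRingType) (n : nat) (M N : 'M[R]_n)
    (i j : 'I_n) :
  unitriangular M -> unitriangular N -> (i < j)%N ->
  (forall k : 'I_n, (i < k < j)%N -> M i k = 0%R \/ N k j = 0%R) ->
  (M *m N)%R i j = (M i j + N i j)%R.
Proof.
move=> uM uN ltij MN0; rewrite mxE (bigD1 i)//= (bigD1 j)/=; last first.
  by rewrite -val_eqE gtn_eqF.
rewrite (uM i i)// (uN j j)// !eqxx mul1r mulr1.
rewrite big1 ?addr0 1?addrC// => k /andP[ki kj].
case: (ltngtP k i) => [ltki|ltik|/val_inj eki]; last by rewrite eki eqxx in ki.
  by rewrite uM ?(ltnW ltki)// eq_sym (negbTE ki) mul0r.
case: (ltngtP k j) => [ltkj|ltjk|/val_inj ekj]; last by rewrite ekj eqxx in kj.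
  by have [|->|->] := MN0 k; rewrite ?ltik ?mul0r ?mulr0.
by rewrite uN ?(ltnW ltjk)// (negbTE kj) mulr0.
Qed.

(** Entries are graded by distance from the diagonal. The mixed terms in entry [(a, b)] of a product
    only involve entries closer to the diagonal, which vanish for a factor deep enough in the
    filtration. *)
Lemma unitriangular_cyclic_or_onto_Z2 (G : groupType) (I : Type)
    (n : I -> nat) (rho : forall i, G -> 'M[int]_(n i)) (K : set G) :
  (forall i g h, rho i (g * h) = (rho i g *m rho i h)%R) ->
  (forall i g, unitriangular (rho i g)) ->
  (forall g, (forall i, rho i g = 1%:M%R) -> g = 1) ->
  is_subgroup K -> cyclic K \/ surjects_onto_Zn 2 K.
Proof.
move=> rhoM uni faithful.
pose L := {i : I & 'I_(n i) * 'I_(n i)}%type.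
pose deg (l : L) := ((tagged l).2 - (tagged l).1)%N.
(* Pairs on or below the diagonal get the zero function, which is trivially additive. *)
pose lam (l : L) g := if ((tagged l).1 < (tagged l).2)%N
  then rho (tag l) g (tagged l).1 (tagged l).2 else 0%R.
have low i (a k b : 'I_(n i)) g :
    filtration deg lam (b - a) g -> (a < k)%N -> (k - a < b - a)%N ->
    rho i g a k = 0%R.
  by move=> /(_ (Tagged _ (a, k))) + ltak ltd; rewrite /lam /deg /= ltak; apply.
have low' i (a k b : 'I_(n i)) g :
    filtration deg lam (b - a) g -> (k < b)%N -> (b - k < b - a)%N ->
    rho i g k b = 0%R.
  by move=> /(_ (Tagged _ (k, b))) + ltkb ltd; rewrite /lam /deg /= ltkb; apply.
apply: (@filtered_cyclic_or_onto_Z2 G L deg lam).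
- move=> [i [a b]] g h /= Fg; rewrite /lam /=.
  case: ltnP => ltab; last by rewrite addr0.
  rewrite rhoM unitriangular_mulmx_entry// => k /andP[ltak ltkb]; left.
  by apply: (low i a k b) => //; apply: ltn_sub2r.
- move=> [i [a b]] g h /= Fg; rewrite /lam /=.
  case: ltnP => ltab; last by rewrite addr0.
  rewrite rhoM unitriangular_mulmx_entry// => k /andP[ltak ltkb]; right.
  by apply: (low' i a k b) => //; apply: ltn_sub2l.
- move=> g lam0; apply: faithful => i; apply/matrixP => a b; rewrite mxE.
  case: (leqP b a) => [leba|ltab]; first exact: uni.
  have := lam0 (Tagged _ (a, b)); rewrite /lam /= ltab => ->.
  by rewrite -val_eqE ltn_eqF.
Qed.

(** * Generation by a free basis *)

Section SubgroupType.
Variables (G : groupType) (S : set G) (sgS : is_subgroup S).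

(** Indexing the type by the closure proof makes that proof available to its group structure. *)
Definition subgroup_type of is_subgroup S : Type := {x : G | x \in S}.

HB.instance Definition _ :=
  SubChoice.copy (subgroup_type sgS) {x : G | x \in S}.
HB.instance Definition _ :=
  SubChoice_isSubGroup.Build G [in S] (subgroup_type sgS) sgS.

End SubgroupType.

(** The inclusion of [B] into the subgroup it generates extends to [F]; followed by the embedding
    back into [F] it fixes [B], so by uniqueness it is the identity. *)
Lemma free_basis_generates (F : groupType) (B : set F) :
  free_basis B -> generated B = setT.
Proof.
move=> freeB; apply/seteqP; split=> // x _.
have sgB := generated_subgroup B; pose T := subgroup_type sgB.
have [phi [phiB _]] := freeB T (fun x => insubd (1 : T) x).
have [psi [_ psi_uniq]] := freeB F idfun.
have vphi : (\val \o phi : F -> F) =1 psi.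
  apply: psi_uniq => b Bb /=; rewrite phiB// val_insubd.
  by rewrite mem_set//; apply: sub_generated.
have idpsi : (idfun : F -> F) =1 psi by apply: psi_uniq.
by rewrite -in_setE -[x]/(idfun x) idpsi -vphi; apply: valP.
Qed.

(** * The group of units of a ring *)

Section UnitGroup.
Variable R : unitRingType.

(** The universal property of a free basis needs a group as target; for matrices this is the group
    of invertible ones. *)
Definition unit_group : Type := {x : R | x \is a GRing.unit}.

HB.instance Definition _ :=
  SubChoice.copy unit_group {x : R | x \is a GRing.unit}.

Let one_unit : unit_group := Sub 1%R (unitr1 R).
Let inv_unit (x : unit_group) : unit_group :=
  Sub (\val x)^-1%R (etrans (unitrV _) (valP x)).
Let mul_unit (x y : unit_group) : unit_group :=
  Sub (\val x * \val y)%R (etrans (unitrMl _ (valP y)) (valP x)).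

Let mul_unitA : associative mul_unit.
Proof. by move=> x y z; apply: val_inj; rewrite /= mulrA. Qed.

Let mul1_unit : left_id one_unit mul_unit.
Proof. by move=> x; apply: val_inj; rewrite /= mul1r. Qed.

Let mul_unit1 : right_id one_unit mul_unit.
Proof. by move=> x; apply: val_inj; rewrite /= mulr1. Qed.

Let mulV_unit : left_inverse one_unit inv_unit mul_unit.
Proof. by move=> x; apply: val_inj; rewrite /= mulVr// (valP x). Qed.

Let mul_unitV : right_inverse one_unit inv_unit mul_unit.
Proof. by move=> x; apply: val_inj; rewrite /= mulrV// (valP x). Qed.

HB.instance Definition _ := isGroup.Build unit_group
  mul_unitA mul1_unit mul_unit1 mulV_unit mul_unitV.

End UnitGroup.

(** * Reduced words *)

Definition syllable_prod (G : groupType) (l : seq (G * int)) : G :=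
  \prod_(p <- l) zexpg p.1 p.2.

Definition reduced (G : groupType) (B : set G) (l : seq (G * int)) : bool :=
  all (fun p => (p.1 \in B) && (p.2 != 0%R)) l &&
  sorted (fun x y : G => x != y) (unzip1 l).

Section ReducedWords.
Variables (G : groupType) (B : set G).

Definition reduced_products : set G :=
  [set g | exists2 l, reduced B l & syllable_prod l = g].

(** The new syllable is put in front, or merged with the first one if the letters agree, and
    disappears if the exponents cancel. *)
Lemma reduced_productsM b (m : int) g :
  B b -> reduced_products g -> reduced_products (zexpg b m * g).
Proof.
move=> Bb [l redl <-].
have bB : b \in B by rewrite in_setE.
have [->|m0] := eqVneq m 0%R; first by rewrite mul1g; exists l.
case: l redl => [_|[c n] l redl].
  exists [:: (b, m)]; first by rewrite /reduced /= bB m0.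
  by rewrite /syllable_prod big_seq1 big_nil mulg1.
have [ecb|cb] := eqVneq b c; last first.
  exists ((b, m) :: (c, n) :: l); last by rewrite /syllable_prod !big_cons.
  by move: redl; rewrite /reduced /= bB m0 cb.
move: redl; rewrite -{c}ecb /reduced /= => /andP[/andP[_ allB] sortl].
have [mn0|mn0] := eqVneq (m + n)%R 0%R.
  exists l; first by rewrite /reduced allB (path_sorted sortl).
  by rewrite /syllable_prod big_cons mulgA -zexpgD mn0 mul1g.
exists ((b, (m + n)%R) :: l); first by rewrite /reduced /= bB mn0 allB.
by rewrite /syllable_prod !big_cons mulgA -zexpgD.
Qed.

(** The elements whose left translation preserves membership in [reduced_products] form a subgroup
    [T]; it contains [B], since multiplying by [b] or [b^-1] keeps products reduced. *)
Lemma generated_reduced : generated B `<=` reduced_products.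
Proof.
pose T := [set g | forall h, reduced_products (g * h) = reduced_products h].
suff BT : generated B `<=` T.
  move=> g /BT /(_ 1); rewrite mulg1 => ->.
  by exists [::]; rewrite // /syllable_prod big_nil.
apply: generated_sub => [|b Bb h].
  apply/is_subgroupP; split=> [h|x y Tx Ty h]; first by rewrite mul1g.
  by rewrite -mulgA Tx -[LHS]Ty mulVKg.
apply/propext; split=> [|/(reduced_productsM 1 Bb)//].
by move=> /(reduced_productsM (-1) Bb); rewrite /= expg1 mulKg.
Qed.

End ReducedWords.

(** * Magnus' unitriangular matrices *)

Section SyllableMatrices.
Variables (G : groupType) (w : seq G).

(** Row [i] stands for the i-th letter of [w]. The last row is zero whatever the default of [nth],
    since its 1 would lie outside the matrix. *)
Definition letter_mx (b : G) : 'M[int]_((size w).+1) :=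
  (\matrix_(i, j) ((nth 1%g w i == b) && (j == i.+1 :> nat))%:R)%R.

(** When [w] has no equal neighbours, [letter_mx b] squares to zero and this is the m-th power of
    [1 + letter_mx b], the image of [b]. *)
Definition syllable_mx (b : G) (m : int) : 'M[int]_((size w).+1) :=
  (1 + m *: letter_mx b)%R.

Hypothesis w_reduced : sorted (fun x y => x != y) w.

(** A nonzero entry would require two consecutive letters of [w] equal to [b]. *)
Lemma letter_mx_sqr b : (letter_mx b * letter_mx b = 0)%R.
Proof.
apply/matrixP => i j; rewrite !mxE big1// => k _; rewrite !mxE.
case: andP => [[/eqP wi /eqP ki]|]; last by rewrite mul0r.
case: andP => [[/eqP wk /eqP jk]|]; last by rewrite mulr0.
have := ltn_ord j; rewrite jk ltnS ki => ltw.
by have /(sortedP 1)/(_ i ltw) := w_reduced; rewrite wi -ki wk eqxx.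
Qed.

Lemma syllable_mx0 b : syllable_mx b 0 = 1%R.
Proof. by rewrite /syllable_mx scale0r addr0. Qed.

Lemma syllable_mxD b m n :
  syllable_mx b (m + n) = (syllable_mx b m * syllable_mx b n)%R.
Proof.
rewrite /syllable_mx mulrDl mul1r mulrDr mulr1 -scalerAl -scalerAr.
by rewrite letter_mx_sqr !scaler0 addr0 scalerDl addrA addrAC.
Qed.

Lemma syllable_mx_unit b m : syllable_mx b m \is a GRing.unit.
Proof.
apply/unitrP; exists (syllable_mx b (- m)).
by rewrite -!syllable_mxD addNr subrr syllable_mx0.
Qed.

Lemma unitriangular_syllable_mx b m : unitriangular (syllable_mx b m).
Proof.
move=> i j leji; rewrite !mxE [(j == _ :> nat)]ltn_eqF ?ltnS// andbF mulr0.
by rewrite addr0.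
Qed.

(* Row i of the column is multiplied by the exponent of its i-th syllable when
   that syllable is prepended, so the last column of the product of the last
   syllables of the word w ends with the product of their exponents. *)
Lemma syllable_mx_prod_col (l1 l2 : seq (G * int)) (i : 'I_(size w).+1) :
  w = unzip1 (l1 ++ l2) -> all (fun p => p.2 != 0%R) l2 -> (i <= size l1)%N ->
  ((\prod_(p <- l2) syllable_mx p.1 p.2) i ord_max != 0)%R
    = (i == size l1 :> nat).
Proof.
elim: l2 l1 i => [|[b m] l2 IHl] l1 i ew /= nz lei.
  have szw : size w = size l1 by rewrite ew cats0 size_map.
  by rewrite big_nil mxE -szw -[i == ord_max]val_eqE; case: (_ == _ :> nat).
case/andP: nz => m0 nz.
have ew' : w = unzip1 (rcons l1 (b, m) ++ l2) by rewrite cat_rcons.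
have IH (k : 'I_(size w).+1) : (k <= (size l1).+1)%N ->
    ((\prod_(p <- l2) syllable_mx p.1 p.2) k ord_max != 0)%R
      = (k == (size l1).+1 :> nat).
  by move=> lek; rewrite (IHl (rcons l1 (b, m)) k ew' nz) size_rcons.
have lti : (i.+1 < (size w).+1)%N.
  rewrite ltnS (leq_ltn_trans lei)// ew size_map size_cat /=.
  by rewrite addnS ltnS leq_addr.
pose k := Ordinal lti.
rewrite big_cons {IHl}; move: (\prod_(p <- l2) _)%R IH => M IH.
rewrite mulrDl mul1r -scalerAl mxE [X in (_ + X)%R]mxE.
(* Row [i] of the product is row [i] of [M] plus a multiple of row [i.+1]; by induction the first
   has last entry zero. *)
have /eqP -> : M i ord_max == 0%R.
  by rewrite -[_ == _]negbK IH ?ltn_eqF// ltnW.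
rewrite add0r mulf_eq0 (negbTE m0) /= mxE (bigD1 k)//= big1 => [|j jk].
  rewrite addr0 mxE eqxx andbT mulf_eq0 negb_or IH//= eqSS.
  case: (eqVneq (i : nat) (size l1)) => [ei|_]; last by rewrite andbF.
  rewrite ei [X in nth _ X _]ew /unzip1 map_cat nth_cat.
  by rewrite size_map ltnn subnn /= eqxx.
rewrite mxE; case: andP => [[_ /eqP ej]|_]; last by rewrite mul0r.
by case/eqP: jk; apply: val_inj.
Qed.

End SyllableMatrices.

(** * Magnus representations of a free group and their joint faithfulness *)

Definition Magnus_representation (F : groupType) (B : set F) (w : seq F)
    (rho : F -> 'M[int]_((size w).+1)) : Prop :=
  [/\ rho 1 = 1%R, forall g h, rho (g * h) = (rho g * rho h)%R
    & forall b m, B b -> rho (zexpg b m) = syllable_mx w b m].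

(** The matrices [syllable_mx w b 1] are invertible, so the universal property applies; additivity
    in the exponent yields the other powers. *)
Lemma Magnus_representation_exists (F : groupType) (B : set F) (w : seq F) :
  free_basis B -> sorted (fun x y => x != y) w ->
  exists rho : F -> 'M[int]_((size w).+1), Magnus_representation B rho.
Proof.
move=> freeB w_red; pose U := unit_group 'M[int]_((size w).+1).
pose u b : U := Sub (syllable_mx w b 1) (syllable_mx_unit w_red b 1).
have [phi [phiB _]] := freeB U u.
have phi1 : \val (phi 1) = 1%R.
  suff -> : phi 1 = 1 by [].
  by apply: (mulgI (phi 1)); rewrite -gmulfM !mulg1.
have phiM g h : \val (phi (g * h)) = (\val (phi g) * \val (phi h))%R.
  by rewrite gmulfM.
exists (fun g => \val (phi g)); split=> // b m Bb.
have phib : \val (phi b) = syllable_mx w b 1 by rewrite phiB.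
have phibV : \val (phi b^-1) = syllable_mx w b (- 1).
  apply: (mulIr (syllable_mx_unit w_red b 1)).
  by rewrite -syllable_mxD// addNr syllable_mx0 -phib -phiM mulVg.
elim/int_rec: m => [|m IHm|m IHm]; first by rewrite phi1 syllable_mx0.
  rewrite intS [(1 + _)%R]addrC zexpgS [(_ + 1)%R]addrC.
  by rewrite syllable_mxD// phiM phib IHm.
rewrite intS opprD [(- 1 + _)%R]addrC zexpgB1 [(_ - 1)%R]addrC.
by rewrite syllable_mxD// phiM phibV IHm.
Qed.

Lemma free_subgroup_cyclic_or_onto_Z2 (F : groupType) (K : set F) :
  free_group F -> is_subgroup K -> cyclic K \/ surjects_onto_Zn 2 K.
Proof.
move=> [B freeB].
have redP g : exists2 l, reduced B l & syllable_prod l = g.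
  by apply: generated_reduced; rewrite (free_basis_generates freeB).
pose I := {w : seq F | sorted (fun x y => x != y) w}.
have [rho rhoP] : exists rho : forall w : I, F -> 'M[int]_((size (val w)).+1),
    forall w, Magnus_representation B (rho w).
  exists (fun w => sval (cid (Magnus_representation_exists freeB (valP w)))) => w.
  exact: svalP.
have rho_prod w l : reduced B l ->
    rho w (syllable_prod l) = (\prod_(p <- l) syllable_mx (val w) p.1 p.2)%R.
  have [rho1 rhoM rhoB] := rhoP w.
  move=> /andP[+ _]; rewrite /syllable_prod.
  elim: l => [|[b m] l IHl] /=; first by rewrite !big_nil.
  move=> /andP[/andP[]]; rewrite in_setE => Bb _ /IHl{}IHl.
  by rewrite !big_cons rhoM IHl rhoB.
apply: (@unitriangular_cyclic_or_onto_Z2 F I (fun w => (size (val w)).+1) rho).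
- by move=> w g h; have [_ -> _] := rhoP w.
- move=> w g; have [l redl <-] := redP g; rewrite rho_prod//.
  elim/big_ind: _ => [|M N uM uN|p _]; first exact: unitriangular1.
    exact: unitriangularM.
  exact: unitriangular_syllable_mx.
- move=> g rho1; have [l redl eg] := redP g.
  (* If [g] has a nonempty reduced word, the representation indexed by the letters of that word has
     a nonzero top right entry at [g], unlike the identity matrix. *)
  have [l_nil|l0] := eqVneq l [::].
    by rewrite -eg l_nil /syllable_prod big_nil.
  have /andP[allB sortl] := redl; move: (rho1 (Sub _ sortl)).
  rewrite -eg rho_prod// => /matrixP/(_ ord0 ord_max).
  have nz : all (fun p => p.2 != 0%R) l by apply: sub_all allB => p /andP[].
  have := syllable_mx_prod_col (w := unzip1 l) (l1 := [::]) (i := ord0)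
    erefl nz (leq0n _).
  have -> : (1%:M : 'M[int]_((size (unzip1 l)).+1))%R ord0 ord_max = 0%R.
    by rewrite mxE -val_eqE /= size_map; case: (l) l0.
  by rewrite eqxx => /eqP.
Qed.

(** * Local 2-indicability of free groups, and conclusion *)

Lemma cyclicE (G : groupType) : @cyclic G = generated_by 1.
Proof.
apply/funext => H; apply/propext; split=> [[x ->]|[s ->]].
  exists [tuple x]; congr generated; apply/seteqP.
  by split=> y /=; rewrite mem_seq1 => /eqP.
exists (thead s); congr generated; case/tupleP: s => x s.
rewrite theadE (tuple0 s).
by apply/seteqP; split=> y /=; rewrite mem_seq1 => /eqP.
Qed.

Lemma free_locally_indicable (F : groupType) :
  free_group F -> locally_indicable 2 F.
Proof.
move=> freeF H [k [s eH]].
have sgH : is_subgroup H by rewrite eH; apply: generated_subgroup.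
case: (free_subgroup_cyclic_or_onto_Z2 freeF sgH) => [|HZ]; last by right.
by rewrite cyclicE; left; exists 1%N.
Qed.

Theorem corollary9 :
  (forall (n : nat) (G : groupType), (2 <= n)%N -> locally_indicable n G ->
     forall H : set G, maximal_generated_by n.-1 H ->
       left_relatively_convex H) /\
  (forall F : groupType, free_group F ->
     forall C : set F, maximal_cyclic C -> left_relatively_convex C).
Proof.
split=> [n G n2 indG H maxH|F freeF C maxC].
  exact: maximal_generated_convex (ltnW n2) indG maxH.
apply: (maximal_generated_convex (n := 2)) => //.
  exact: free_locally_indicable.
by rewrite /maximal_generated_by /= -cyclicE.
Qed.
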